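(* Let $G$ be a finite, simple, connected graph with $d+1$ distinct eigenvalues and preintersection numbers $\gamma_i$. (i) If $d\ge 2$ and $\gamma_1=\cdots=\gamma_{d-1}=1$, then $G$ is distance-regular. (ii) If $d\ge 3$, $G$ is bipartite, and $\gamma_1=\cdots=\gamma_{d-2}=1$, then $G$ is distance-regular.
   Context: Let $G$ be a finite, simple, connected graph on $n$ vertices with adjacency matrix $A$, whose distinct eigenvalues are $\lambda_0>\cdots>\lambda_d$ with multiplicities $m_0,\ldots,m_d$. On the space $\mathbb{R}_d[x]$ of real polynomials of degree at most $d$ use the scalar product $\langle p,q\rangle_G=\frac1n\operatorname{tr}(p(A)q(A))=\frac1n\sum_{i=0}^d m_i p(\lambda_i)q(\lambda_i)$. The predistance polynomials $p_0,\ldots,p_d$ are the unique orthogonal sequence with $\deg p_i=i$ and $\|p_i\|_G^2=p_i(\lambda_0)$. The preintersection numbers $\alpha_i,\beta_i,\gamma_i$ are the coefficients of the three-term recurrence $xp_i=\beta_{i-1}p_{i-1}+\alpha_ip_i+\gamma_{i+1}p_{i+1}$, $i=0,\ldots,d$, as functions on $\{\lambda_0,\ldots,\lambda_d\}$ (equivalently modulo $\prod_i (x-\lambda_i)$, which matters only for $i=d$), with conventions $\beta_{-1}=\gamma_{d+1}=0$, $p_{-1}=p_{d+1}=0$, $\gamma_0=\beta_d=0$. For vertices $u,v$ at distance $i$, let $c_i(u,v),a_i(u,v),b_i(u,v)$ be the number of neighbours of $v$ at distance $i-1$, $i$, $i+1$ from $u$, respectively. A graph of diameter $D$ is distance-regular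 if for each $i=0,\ldots,D$ these three numbers do not depend on the choice of $u,v$ at distance $i$. *)

(* Defs.v *)
From mathcomp Require Import all_boot all_order all_algebra.
From mathcomp Require Import reals.

Set Implicit Arguments.
Unset Strict Implicit.
Unset Printing Implicit Defensive.

Import Order.TTheory GRing.Theory Num.Theory.

(* A simple graph on T is a symmetric irreflexive relation e : rel T. *)

Definition connected_graph (T : finType) (e : rel T) : Prop :=
  forall u v : T, connect e u v.

Definition bipartite_graph (T : finType) (e : rel T) : Prop :=
  exists f : T -> bool, forall u v : T, e u v -> f u != f v.

Definition has_walk (T : finType) (e : rel T) (u v : T) (k : nat) : bool :=
  [exists s : k.-tuple T, path e u s && (last u s == v)].

(* A shortest walk has length < #|T|; if there is no walk from u to v at all,
   the value is #|T|, which cannot occur in a connected graph. *)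
Definition gdist (T : finType) (e : rel T) (u v : T) : nat :=
  find (has_walk e u v) (iota 0 #|T|).

Definition diameter (T : finType) (e : rel T) : nat :=
  \max_(u : T) \max_(v : T) gdist e u v.

(* c_i(u,v), a_i(u,v), b_i(u,v), where i is the distance from u to v. *)
Definition c_num (T : finType) (e : rel T) (u v : T) : nat :=
  #|[set w | e v w & (gdist e u w).+1 == gdist e u v]|.
Definition a_num (T : finType) (e : rel T) (u v : T) : nat :=
  #|[set w | e v w & gdist e u w == gdist e u v]|.
Definition b_num (T : finType) (e : rel T) (u v : T) : nat :=
  #|[set w | e v w & gdist e u w == (gdist e u v).+1]|.

Definition distance_regular (T : finType) (e : rel T) : Prop :=
  forall i : nat, i <= diameter e ->
  forall u v u' v' : T, gdist e u v = i -> gdist e u' v' = i ->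
    [/\ c_num e u v = c_num e u' v',
        a_num e u v = a_num e u' v'
      & b_num e u v = b_num e u' v'].

Local Open Scope ring_scope.

(* Connected graphs are nonempty, so the vertex set is taken to be 'I_n.+1;
   the number of vertices is n.+1. *)

Definition adjmx (R : realType) (n : nat) (e : rel 'I_n.+1) : 'M[R]_n.+1 :=
  \matrix_(i, j) (e i j)%:R.

Definition distinct_eigenvalues (R : realType) (n : nat) (e : rel 'I_n.+1)
    (d : nat) (lam : 'I_d.+1 -> R) : Prop :=
  (forall i j : 'I_d.+1, (i < j)%N -> lam j < lam i) /\
  (forall x : R, eigenvalue (adjmx R e) x <-> exists i, lam i = x).

Definition graph_sprod (R : realType) (n : nat) (e : rel 'I_n.+1)
    (p q : {poly R}) : R :=
  \tr (horner_mx (adjmx R e) p *m horner_mx (adjmx R e) q) / n.+1%:R.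

(* Only p 0, ..., p d are constrained. *)
Definition predistance_polys (R : realType) (n : nat) (e : rel 'I_n.+1)
    (d : nat) (lam : 'I_d.+1 -> R) (p : nat -> {poly R}) : Prop :=
  [/\ forall i, (i <= d)%N -> size (p i) = i.+1,
      forall i j, (i <= d)%N -> (j <= d)%N -> i != j ->
        graph_sprod e (p i) (p j) = 0
    & forall i, (i <= d)%N ->
        graph_sprod e (p i) (p i) = (p i).[lam ord0]].

(* The three-term recurrence is an identity of functions on the spectrum.
   The terms beta_{-1} p_{-1} (when i = 0) and gamma_{d+1} p_{d+1} (when i = d)
   are zero. *)
Definition preintersection_numbers (R : realType) (d : nat)
    (lam : 'I_d.+1 -> R) (p : nat -> {poly R})
    (alpha beta gamma : nat -> R) : Prop :=
  [/\ gamma 0%N = 0, beta d = 0, gamma d.+1 = 0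
    & forall (i : nat) (j : 'I_d.+1), (i <= d)%N ->
        lam j * (p i).[lam j] =
          (if i is k.+1 then beta k * (p k).[lam j] else 0)
          + alpha i * (p i).[lam j]
          + gamma i.+1 * (p i.+1).[lam j]].

(* Main.v *)
(* Entrywise positivity turns the normalization [|p_i|^2 = p_i(lam_0)] into a
   rigidity statement. As [x p_0 = p_1] when [gamma_1 = 1], it says for [i = 1]
   that [lam_0] is the average degree, so the graph is regular; then [p_i(lam_0)]
   is the average row sum of [p_i(A)], so the entries [z] of [p_i(A)] satisfy
   [sum (z^2 - z) = 0]. If [gamma_i = 1] and [p_j(A)] is the distance-j matrix
   [A_j] for [j < i], the recurrence gives natural entries to [p_i(A)] except at
   distances [i-2] and [i-1], where orthogonality to [A_(i-2)] and [A_(i-1)] cancels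
   the linear terms; hence [p_i(A) = A_i]. The remaining [p_i(A)] follow from
   the Hoffman identity [sum_i p_i(A) = J], with the help, in the bipartite case,
   of the parity of [p_(d-1)(A)] and [p_d(A)]. *)
Require Import Defs.
From mathcomp Require Import all_boot all_order all_algebra.
From mathcomp Require Import reals.
From mathcomp Require Import complex.
From mathcomp Require Import ring zify.

Import Order.TTheory GRing.Theory Num.Theory.
Local Open Scope ring_scope.

(** * Polynomials in a real symmetric matrix *)

(** Over [R[i]] the matrix is Hermitian, hence unitarily similar to a diagonal matrix with real
    entries. These entries are eigenvalues of [A], so [q] annihilates the diagonal. *)
Lemma sym_horner_mx_eq0 {R : rcfType} {n : nat} {A : 'M[R]_n.+1} (q : {poly R}) :
  A^T = A -> (forall a, eigenvalue A a -> root q a) -> horner_mx A q = 0.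
Proof.
move=> Asym qA; pose f : {rmorphism R -> R[i]} := real_complex R.
apply: (@map_mx_inj _ _ f); rewrite map_horner_mx map_mx0.
set B := map_mx f A.
have Bherm : B \is hermitianmx _ false Num.Def.conjC.
  apply: realsym_hermsym.
    apply/is_hermitianmxP; rewrite expr0 scale1r.
    by apply/matrixP => i j; rewrite !mxE -{1}Asym mxE.
  by apply/mxOverP => i j; rewrite mxE; apply/complex_realP; exists (A i j).
have Dreal := mxOverP (hermitian_spectral_diag_real Bherm).
have /hermitian_normalmx /orthomx_spectralP := Bherm.
have Punit := spectral_unit B; move: Dreal Punit.
set P := spectralmx B; set D := spectral_diag B => Dreal Punit BE.
rewrite BE horner_mx_uconjC; last exact: Punit.
rewrite horner_mx_diag.
suff -> : map_mx (horner (map_poly f q)) D = 0 by rewrite raddf0 mulmx0 mul0mx.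
apply/rowP => i; rewrite !mxE; apply/eqP; have /complex_realP [a Da] := Dreal 0 i.
rewrite Da; change (a%:C)%C with (f a); rewrite horner_map fmorph_eq0.
apply: qA; rewrite -(eigenvalue_map f); apply/eigenvalueP.
(* Row [i] of the diagonalizing matrix [P] is a left eigenvector for the [i]-th diagonal entry. *)
exists ((delta_mx 0 i : 'rV_n.+1) *m P); last first.
  apply/eqP => /(congr1 (mulmx^~ (invmx P))); rewrite mulmxK // mul0mx.
  by move/rowP/(_ i)/eqP; rewrite !mxE !eqxx oner_eq0.
change ((delta_mx 0 i : 'rV_n.+1) *m P *m B = f a *: (delta_mx 0 i *m P)).
rewrite [in LHS]BE !mulmxA mulmxK //.
have -> : (delta_mx 0 i : 'rV_n.+1) *m diag_mx D = f a *: delta_mx 0 i.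
  apply/rowP => j; rewrite mul_mx_diag !mxE !eqxx /=.
  by case: eqP => [->|_]; rewrite ?mul0r ?mulr0 // mul1r mulr1 Da.
by rewrite scalemxAl.
Qed.

Lemma horner_mx_sym {R : comNzRingType} {n : nat} (A : 'M[R]_n.+1) (q : {poly R}) :
  A^T = A -> (horner_mx A q)^T = horner_mx A q.
Proof.
move=> Asym; elim/poly_ind: q => [|q c IHq]; first by rewrite rmorph0 trmx0.
rewrite rmorphD rmorphM /= horner_mx_X horner_mx_C linearD /= tr_scalar_mx.
by rewrite -mulmxE trmx_mul Asym IHq (comm_mx_horner q (comm_mx_refl A)).
Qed.

Lemma mxtrace_mul_sym {R : comPzRingType} {n : nat} (M N : 'M[R]_n) :
  N^T = N -> \tr (M *m N) = \sum_u \sum_v M u v * N u v.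
Proof.
move=> Nsym; apply: eq_bigr => u _; rewrite mxE.
by apply: eq_bigr => v _; rewrite -{1}Nsym mxE.
Qed.

(** By symmetry the trace is the sum of the squares of the entries. *)
Lemma mxtrace_sym_sqr_eq0 {R : realDomainType} {n : nat} (M : 'M[R]_n) :
  M^T = M -> \tr (M *m M) = 0 -> M = 0.
Proof.
move=> Msym; rewrite mxtrace_mul_sym // => /eqP.
rewrite psumr_eq0 => [|u _]; last by apply: sumr_ge0 => v _; rewrite -expr2 sqr_ge0.
move=> /allP M0; apply/matrixP => u v; rewrite mxE.
move: (M0 u (mem_index_enum _)); rewrite psumr_eq0 => [|w _]; last first.
  by rewrite -expr2 sqr_ge0.
by move=> /allP/(_ v (mem_index_enum _)); rewrite /= mulf_eq0 orbb => /eqP.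
Qed.

Lemma horner_mx_eigen {R : comNzRingType} {n m : nat} (A : 'M[R]_n.+1)
    (a : R) (v : 'M[R]_(n.+1, m)) (q : {poly R}) :
  A *m v = a *: v -> horner_mx A q *m v = q.[a] *: v.
Proof.
move=> Av; elim/poly_ind: q => [|q c IHq].
  by rewrite rmorph0 mul0mx horner0 scale0r.
rewrite rmorphD rmorphM /= horner_mx_X horner_mx_C mulmxDl -mulmxE -mulmxA Av.
by rewrite -scalemxAr IHq mul_scalar_mx hornerMXaddC scalerDl scalerA mulrC.
Qed.

(** * Walks and distances in a connected graph *)

Section Distance.

Variables (T : finType) (e : rel T).
Hypotheses (e_sym : symmetric e) (e_conn : connected_graph e).

Lemma has_walkP (u v : T) (k : nat) :
  reflect (exists s, [/\ size s = k, path e u s & last u s = v]) (has_walk e u v k).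
Proof.
apply: (iffP existsP) => [[s /andP[us /eqP sv]]|[s [/eqP sk us sv]]].
  by exists s; rewrite size_tuple.
by exists (Tuple sk); rewrite us sv eqxx.
Qed.

Lemma has_walk0 (u v : T) : has_walk e u v 0 = (u == v).
Proof.
apply/has_walkP/eqP => [[s [/size0nil -> _]] //|->].
by exists [::].
Qed.

Lemma has_walkS (u v : T) (k : nat) :
  has_walk e u v k.+1 = [exists w, has_walk e u w k && e w v].
Proof.
apply/has_walkP/existsP => [[s]|[w /andP[/has_walkP[s [sk us sw]] wv]]].
  elim/last_ind: s => [[] //|s w _]; rewrite size_rcons rcons_path last_rcons.
  move=> [[sk] /andP[us sw] <-]; exists (last u s); rewrite sw andbT.
  by apply/has_walkP; exists s.
exists (rcons s v); rewrite size_rcons rcons_path last_rcons sk us sw.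
by split.
Qed.

(** A walk can be shortened until no vertex repeats. Hence the default value of [find] in [gdist]
    never occurs. *)
Lemma gdist_lt_card (u v : T) : (gdist e u v < #|T|)%N.
Proof.
rewrite /gdist -{2}(size_iota 0 #|T|) -has_find.
have /connectP[s us ->] := e_conn u v.
have [s' us' /card_uniqP us'E _] := shortenP us.
apply/hasP; exists (size s'); last by apply/has_walkP; exists s'.
by rewrite mem_iota add0n /=; move: (max_card (mem (u :: s'))); rewrite us'E.
Qed.

Lemma has_walk_gdist (u v : T) : has_walk e u v (gdist e u v).
Proof.
have uv := gdist_lt_card u v.
have := @nth_find _ 0%N (has_walk e u v) (iota 0 #|T|).
by rewrite nth_iota ?add0n //; apply; rewrite has_find size_iota.
Qed.

Lemma gdist_le (u v : T) (k : nat) : has_walk e u v k -> (gdist e u v <= k)%N.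
Proof.
move=> uvk; rewrite leqNgt; apply/negP => ltk.
have := before_find 0%N ltk.
by rewrite nth_iota ?(ltn_trans ltk (gdist_lt_card u v)) // add0n uvk.
Qed.

Lemma gdist_eq0 (u v : T) : (gdist e u v == 0%N) = (u == v).
Proof.
apply/eqP/eqP => [uv|->]; last first.
  by apply/eqP; rewrite -leqn0; apply: gdist_le; rewrite has_walk0.
by have := has_walk_gdist u v; rewrite uv has_walk0 => /eqP.
Qed.

Lemma gdist_edge (u v w : T) : e v w -> (gdist e u w <= (gdist e u v).+1)%N.
Proof.
move=> vw; apply: gdist_le; rewrite has_walkS; apply/existsP; exists v.
by rewrite has_walk_gdist.
Qed.

Lemma gdist_pred (u v : T) (i : nat) :
  gdist e u v = i.+1 -> exists2 w, e v w & gdist e u w = i.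
Proof.
move=> uv; have := has_walk_gdist u v; rewrite uv has_walkS.
move=> /existsP[w /andP[uw wv]]; exists w; first by rewrite e_sym.
apply/eqP; rewrite eqn_leq gdist_le //=.
by have := gdist_edge u w v wv; rewrite uv ltnS.
Qed.

Lemma gdist_eq1 (u v : T) : irreflexive e -> (gdist e u v == 1%N) = e u v.
Proof.
move=> e_irr; apply/eqP/idP => [/gdist_pred[w vw /eqP]|uv].
  by rewrite gdist_eq0 => /eqP ->; rewrite e_sym.
apply/eqP; rewrite eqn_leq lt0n gdist_eq0 andbC.
have := gdist_edge u u v uv.
have /eqP -> : gdist e u u == 0%N by rewrite gdist_eq0.
by move=> ->; rewrite andbT; apply/eqP => uvE; rewrite uvE e_irr in uv.
Qed.

(** Each edge of a shortest walk changes the side. *)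
Lemma bipartite_gdist (f : T -> bool) :
  (forall u v : T, e u v -> f u != f v) ->
  forall u v, f u (+) f v = odd (gdist e u v).
Proof.
move=> fP u v; move: {2}(gdist e u v) (erefl (gdist e u v)) => k.
elim: k v => [|k IHk] v.
  by move=> g; rewrite g; move/eqP: g; rewrite gdist_eq0 => /eqP ->; rewrite addbb.
move=> uv; have [w vw uw] := gdist_pred _ _ _ uv.
have := IHk w uw; rewrite uv uw /= => <-.
by have := fP v w vw; case: (f u); case: (f v); case: (f w).
Qed.

(** Indexed by the target distance [i], this count is an entry of [A_i A]. Taking [i] one below,
    equal to, or one above [gdist e u v] gives [c_num], [a_num] and [b_num]. *)
Definition nbr_num (i : nat) (u v : T) : nat :=
  #|[set w | e v w & gdist e u w == i]|.

Lemma nbr_num_neq0 (i : nat) (u v : T) :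
  nbr_num i u v != 0%N -> (i <= (gdist e u v).+1)%N && (gdist e u v <= i.+1)%N.
Proof.
rewrite -lt0n => /card_gt0P[w]; rewrite inE => /andP[vw /eqP <-].
by rewrite !gdist_edge // e_sym.
Qed.

Lemma nbr_num_gt0 (i : nat) (u v : T) : gdist e u v = i.+1 -> (0 < nbr_num i u v)%N.
Proof.
move=> /gdist_pred[w vw uw]; apply/card_gt0P; exists w.
by rewrite inE vw uw eqxx.
Qed.

Lemma distance_regular_nbr_num :
  (forall i u v u' v', gdist e u v = gdist e u' v' ->
     nbr_num i u v = nbr_num i u' v') ->
  distance_regular e.
Proof.
move=> nbrP _ _ u v u' v' <- guv; split.
- rewrite /c_num guv; case g: (gdist e u v) => [|k].
    (* At distance 0 both sets are empty, since a successor is never 0. *)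
    by apply: eq_card => w; rewrite !inE; case: (e v w); case: (e v' w).
  by have := nbrP k _ _ _ _ (esym guv).
- by rewrite /a_num guv; exact: nbrP.
- by rewrite /b_num guv; exact: nbrP.
Qed.

End Distance.

(** Newton's step: a multiple of [m], which vanishes at the earlier nodes, corrects the value at the
    new node [a]. *)
Lemma poly_interpolation {F : fieldType} (s : seq F) (y : F -> F) :
  uniq s -> exists q : {poly F}, forall x, x \in s -> q.[x] = y x.
Proof.
elim: s => [|a s IHs] /=; first by exists 0.
move=> /andP[sa /IHs[q qs]]; pose m := \prod_(z <- s) ('X - z%:P).
have ma : m.[a] != 0 by rewrite -/(root m a) root_prod_XsubC.
exists (q + ((y a - q.[a]) / m.[a]) *: m) => x; rewrite inE hornerD hornerZ.
move=> /predU1P[->|sx]; first by rewrite divfK // addrC subrK.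
have /rootP -> : root m x by rewrite root_prod_XsubC.
by rewrite mulr0 addr0 qs.
Qed.

(** * Distance matrices and polynomials in the adjacency matrix *)

Section Graph.

Variables (R : realType) (n : nat) (e : rel 'I_n.+1).
Hypotheses (e_sym : symmetric e) (e_irr : irreflexive e) (e_conn : connected_graph e).

Local Notation A := (adjmx R e).
Local Notation one := (const_mx 1 : 'cV[R]_n.+1).

Definition distmx (i : nat) : 'M[R]_n.+1 := \matrix_(u, v) (gdist e u v == i)%:R.

Lemma adjmx_sym : A^T = A.
Proof. by apply/matrixP => u v; rewrite !mxE e_sym. Qed.

Lemma distmx_adjmx (i : nat) (u v : 'I_n.+1) :
  (distmx i *m A) u v = (nbr_num _ e i u v)%:R.
Proof.
rewrite mxE /nbr_num -sum1dep_card natr_sum [RHS]big_mkcond /=.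
apply: eq_bigr => w _; rewrite !mxE e_sym; case: (e v w); rewrite ?mulr0 //=.
by rewrite mulr1; case: (_ == _).
Qed.

Lemma distmx0 : distmx 0 = 1%:M.
Proof. by apply/matrixP => u v; rewrite !mxE gdist_eq0. Qed.

Lemma distmx1 : distmx 1 = A.
Proof. by apply/matrixP => u v; rewrite !mxE gdist_eq1. Qed.

(** The size of a polynomial is its degree plus one, so only powers of [A] with exponent below the
    distance occur, and no walk of such a length joins [u] to [v]. *)
Lemma horner_adjmx_gdist (q : {poly R}) (u v : 'I_n.+1) :
  (size q <= gdist e u v)%N -> horner_mx A q u v = 0.
Proof.
move=> ltq; suff powA k : (k < gdist e u v)%N -> (A ^+ k) u v = 0.
  rewrite -[q]coefK poly_def rmorph_sum summxE big1 //= => i _.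
  rewrite linearZ /= mxE rmorphXn /= horner_mx_X powA ?mulr0 //.
  exact: leq_trans (ltn_ord i) ltq.
elim: k v {ltq} => [|k IHk] v ltk.
  by rewrite expr0 mxE -(gdist_eq0 _ _ e_conn) -leqn0 leqNgt ltk.
rewrite exprSr -mulmxE mxE big1 // => w _; rewrite [A w v]mxE.
case wv: (e w v); rewrite ?mulr0 // IHk ?mul0r //.
by have := gdist_edge _ _ e_conn u w v wv; move: ltk; lia.
Qed.

(** Maximum principle: the graph is regular of degree [a], so at a vertex where [v] is maximal the
    nonnegative gaps to the neighbours sum to 0. The maximum thus spreads along edges, and by
    connectedness to all vertices. *)
Lemma adjmx_eigen_const (a : R) (v : 'cV[R]_n.+1) (i j : 'I_n.+1) :
  A *m one = a *: one -> A *m v = a *: v -> v i 0 = v j 0.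
Proof.
move=> A1 Av; pose u := [arg max_(w > i) v w 0]%O.
have umax w : v w 0 <= v u 0 by rewrite /u; case: arg_maxP => // x _; apply.
suff vu w : v w 0 = v u 0 by rewrite !vu.
have step x y : v x 0 = v u 0 -> e x y -> v y 0 = v u 0.
  move=> xu xy; have : \sum_z A x z * (v u 0 - v z 0) = 0.
    under eq_bigr do rewrite mulrBr; rewrite sumrB -mulr_suml.
    have /matrixP/(_ x 0) := Av; rewrite !mxE => ->; rewrite xu.
    have /matrixP/(_ x 0) := A1; rewrite !mxE mulr1 => <-.
    under [in X in _ - X * _]eq_bigr => z _ do rewrite [one z 0]mxE mulr1.
    by rewrite subrr.
  move=> /eqP; rewrite psumr_eq0 => [/allP/(_ y (mem_index_enum _))|z _].
    by rewrite mxE xy mul1r subr_eq0 => /eqP.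
  by rewrite mulr_ge0 ?subr_ge0 // mxE ler0n.
have /connectP[s us ->] := e_conn u w.
suff: forall x, v x 0 = v u 0 -> path e x s -> v (last x s) 0 = v u 0 by apply.
by elim: s {us} => [|y s IHs] x //= xu /andP[xy]; apply: IHs; apply: step xu xy.
Qed.

Lemma sum_mx_one (M : 'M[R]_n.+1) (a : R) :
  M *m one = a *: one -> \sum_u \sum_v M u v = n.+1%:R * a.
Proof.
move=> M1; transitivity (\sum_(u < n.+1) a).
  apply: eq_bigr => u _; have /matrixP/(_ u 0) := M1; rewrite !mxE mulr1 => <-.
  by apply: eq_bigr => v _; rewrite [one v 0]mxE mulr1.
by rewrite sumr_const card_ord mulr_natl.
Qed.

Lemma graph_sprodE (p q : {poly R}) :
  n.+1%:R * graph_sprod e p q = \tr (horner_mx A (p * q)).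
Proof. by rewrite /graph_sprod mulrC divfK ?pnatr_eq0 // rmorphM. Qed.

Lemma graph_sprod_sum (p q : {poly R}) :
  n.+1%:R * graph_sprod e p q =
  \sum_u \sum_v horner_mx A p u v * horner_mx A q u v.
Proof.
rewrite graph_sprodE rmorphM /= -mulmxE mxtrace_mul_sym //.
exact: horner_mx_sym adjmx_sym.
Qed.

Lemma distance_regular_distmx :
  (forall i, exists F : nat -> R, forall u v,
     (distmx i *m A) u v = F (gdist e u v)) ->
  distance_regular e.
Proof.
move=> H; apply: distance_regular_nbr_num => i u v u' v' guv.
have [F FE] := H i; apply/eqP; rewrite -(eqr_nat R) -!distmx_adjmx !FE guv.
by [].
Qed.


(** * Spectrum, predistance polynomials and their recurrence *)

Variables (d : nat) (lam : 'I_d.+1 -> R) (p : nat -> {poly R}).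
Variables (alpha beta gamma : nat -> R).
Hypotheses (lam_spec : distinct_eigenvalues e lam) (p_pre : predistance_polys e lam p).
Hypothesis (abc_pre : preintersection_numbers lam p alpha beta gamma).

Local Notation pA i := (horner_mx A (p i)).

Lemma lam_inj : injective lam.
Proof.
move=> i j ij; apply: val_inj; case: lam_spec => lt_lam _.
by case: (ltngtP i j) => // /lt_lam; rewrite ij ltxx.
Qed.

Lemma spectrum_uniq : uniq [seq lam j | j <- enum 'I_d.+1].
Proof. by rewrite map_inj_uniq ?enum_uniq //; exact: lam_inj. Qed.

Lemma horner_adjmx_spectrum (q : {poly R}) :
  (forall j, q.[lam j] = 0) -> horner_mx A q = 0.
Proof.
move=> q0; apply: sym_horner_mx_eq0 adjmx_sym _ => a.
by move=> /(proj2 lam_spec a)[j <-]; rewrite rootE q0.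
Qed.

Lemma poly_spectrum_eq0 (q : {poly R}) :
  (size q <= d.+1)%N -> (forall j, q.[lam j] = 0) -> q = 0.
Proof.
move=> leq q0; apply: roots_geq_poly_eq0 spectrum_uniq _.
  by apply/allP => x /mapP[j _ ->]; rewrite rootE q0.
by rewrite size_map size_enum_ord.
Qed.

(** The minimal polynomial divides [q] and has all [d + 1] eigenvalues as roots, too many for the
    degree of [q] unless [q = 0]. *)
Lemma horner_adjmx_eq0 (q : {poly R}) :
  (size q <= d.+1)%N -> horner_mx A q = 0 -> q = 0.
Proof.
move=> leq qA; apply: poly_spectrum_eq0 => // j; apply/eqP.
have /dvdpP[r ->] : (mxminpoly A %| q)%R by apply: mxminpoly_min.
rewrite hornerM mulf_eq0; apply/orP; right; rewrite -/(root _ _).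
by rewrite -eigenvalue_root_min; apply/(proj2 lam_spec _); exists j.
Qed.

Lemma graph_sprod_neq0 (q : {poly R}) :
  (size q <= d.+1)%N -> q != 0 -> graph_sprod e q q != 0.
Proof.
move=> leq; apply: contraNneq => q0; apply/eqP; apply: horner_adjmx_eq0 => //.
apply: mxtrace_sym_sqr_eq0; first exact: horner_mx_sym adjmx_sym.
by rewrite mulmxE -rmorphM /= -graph_sprodE q0 mulr0.
Qed.

Lemma size_predist i : (i <= d)%N -> size (p i) = i.+1.
Proof. by case: p_pre => + _ _; apply. Qed.

(** For a constant [c] the norm condition reads [c * c = c], and the size condition excludes
    [c = 0]. *)
Lemma predist0 : p 0%N = 1.
Proof.
have [sp _ np] := p_pre; have /size_poly1P[c c0 pc] : size (p 0%N) == 1%N by rewrite sp.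
have := np 0%N isT; rewrite pc hornerC /graph_sprod horner_mx_C -scalar_mxM.
rewrite mxtrace_scalar -[(c * c) *+ _]mulr_natr mulfK ?pnatr_eq0 // => cc.
by rewrite (mulfI c0 (etrans cc (esym (mulr1 c)))).
Qed.

(** For [i < d] both sides have degree at most [d], so agreement at the [d + 1] eigenvalues makes
    them equal as polynomials. *)
Lemma predist_recurrence i : (i < d)%N ->
  p i * 'X = (if i is k.+1 then beta k *: p k else 0) + alpha i *: p i
             + gamma i.+1 *: p i.+1.
Proof.
move=> ltid; apply/eqP; rewrite -subr_eq0; apply/eqP; apply: poly_spectrum_eq0.
  have sp : forall k, (k <= i.+1)%N -> (size (p k) <= d.+1)%N.
    by move=> k ki; rewrite size_predist; move: ki ltid; lia.
  apply: leq_trans (size_polyD _ _) _; rewrite size_polyN geq_max.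
  have pi0 : p i != 0 by rewrite -size_poly_eq0 size_predist // ltnW.
  rewrite size_mulX // size_predist ?(ltnW ltid) //= ltnS ltid /=.
  apply: leq_trans (size_polyD _ _) _; rewrite geq_max.
  rewrite !(leq_trans (size_scale_leq _ _)) ?sp // andbT.
  apply: leq_trans (size_polyD _ _) _; rewrite geq_max.
  rewrite !(leq_trans (size_scale_leq _ _)) ?sp // andbT.
  case: (i) sp => [|k] sp; first by rewrite size_poly0.
  by apply: leq_trans (size_scale_leq _ _) (sp _ _); lia.
move=> j; case: abc_pre => _ _ _ /(_ i j (ltnW ltid)).
rewrite !hornerE /= mulrC => ->.
by case: (i) => [|k]; rewrite ?horner0 ?hornerZ subrr.
Qed.

Lemma predist_adjmx i : (i < d)%N ->
  pA i *m A = (if i is k.+1 then beta k *: pA k else 0) + alpha i *: pA i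
              + gamma i.+1 *: pA i.+1.
Proof.
move=> ltid; rewrite mulmxE -[X in _ * X]horner_mx_X -rmorphM /=.
rewrite predist_recurrence // !rmorphD /= !linearZ /=.
by case: (i) => [|k]; rewrite ?rmorph0 ?linearZ.
Qed.

(** Without the last term the recurrence would bound the degree of [x p_i] by [i]. *)
Lemma gamma_neq0 i : (i < d)%N -> gamma i.+1 != 0.
Proof.
move=> ltid; apply/eqP => g0.
have := congr1 (fun q : {poly R} => size q) (predist_recurrence i ltid).
have pi0 : p i != 0 by rewrite -size_poly_eq0 size_predist // ltnW.
rewrite g0 scale0r addr0 size_mulX // size_predist ?(ltnW ltid) //= => sE.
suff : (i.+2 <= i.+1)%N by rewrite ltnn.
rewrite [X in (X <= _)%N]sE; apply: leq_trans (size_polyD _ _) _; rewrite geq_max.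
rewrite !(leq_trans (size_scale_leq _ _)) ?size_predist ?(ltnW ltid) // andbT.
move: ltid; case: (i) => [|k] ltid; first by rewrite size_poly0.
by apply: leq_trans (size_scale_leq _ _) _; rewrite size_predist; lia.
Qed.

Lemma predist_orth i j : (i <= d)%N -> (j <= d)%N -> i != j ->
  \sum_u \sum_v pA i u v * pA j u v = 0.
Proof.
move=> id jd ij; rewrite -graph_sprod_sum; case: p_pre => _ + _.
by move=> ->; rewrite ?mulr0.
Qed.

Lemma predist_norm i : (i <= d)%N ->
  \sum_u \sum_v pA i u v * pA i u v = n.+1%:R * (p i).[lam ord0].
Proof. by move=> id; rewrite -graph_sprod_sum; case: p_pre => _ _ ->. Qed.

(* [<x, x> = lam_0] says that the all-ones vector attains the Rayleigh bound
   [lam_0]; [s(A)] below is a square root of [lam_0 - A]. *)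
Lemma predist1_regular : (0 < d)%N -> gamma 1%N = 1 ->
  p 1%N = 'X /\ A *m one = lam ord0 *: one.
Proof.
move=> d0 g1; have := predist_recurrence 0 d0.
rewrite predist0 mul1r add0r g1 scale1r alg_polyC => XE.
have trA : \tr A = 0 by apply: big1 => u _; rewrite mxE e_irr.
(* Here [p_1 = x - alpha_0], and [A] has trace 0, so orthogonality to [p_0 = 1] forces
   [alpha_0 = 0]. *)
have a0 : alpha 0%N = 0.
  have : graph_sprod e (p 1%N) (p 0%N) = 0 by case: p_pre => _ + _; apply.
  move=> /(congr1 ( *%R n.+1%:R)); rewrite graph_sprodE predist0 mulr1 mulr0.
  rewrite -[p 1%N](addKr (alpha 0%N)%:P) -XE rmorphD rmorphN /= horner_mx_X horner_mx_C.
  rewrite linearD linearN /= trA mxtrace_scalar addr0 => /eqP.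
  by rewrite oppr_eq0 -mulr_natr mulf_eq0 pnatr_eq0 orbF => /eqP.
have p1 : p 1%N = 'X by rewrite XE a0 add0r.
split=> //; pose r x := Num.sqrt (lam ord0 - x).
have [s sP] := poly_interpolation _ r spectrum_uniq.
have sA : horner_mx A s *m horner_mx A s = (lam ord0)%:M - A.
  apply/eqP; rewrite -subr_eq0 mulmxE -rmorphM /= -(horner_mx_C A) -{3}(horner_mx_X A).
  rewrite -!rmorphB /=; apply/eqP; apply: horner_adjmx_spectrum => j.
  rewrite !hornerE sP ?map_f ?mem_enum // -expr2 sqr_sqrtr ?subrr // subr_ge0.
  have [->//|j0] := eqVneq j ord0; apply/ltW; apply: (proj1 lam_spec).
  by rewrite lt0n.
have s1 : horner_mx A s *m one = 0.
  pose w := horner_mx A s *m one.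
  have : (w^T *m w) 0 0 = 0.
    rewrite /w trmx_mul horner_mx_sym ?adjmx_sym // -mulmxA (mulmxA (horner_mx A s)) sA.
    (* The entries of [A] are 0 or 1, hence equal to their squares, so the norm of [p_1 = x] gives
       their sum: [lam_0] times the number of vertices. *)
    have := predist_norm 1 d0; rewrite p1 horner_mx_X hornerX => XX.
    rewrite trmx_const mulmxBl mulmxBr mul_scalar_mx -scalemxAr !mxE.
    under eq_bigr do rewrite !mxE mulr1.
    rewrite sumr_const card_ord mulrC -XX; apply/eqP; rewrite subr_eq0.
    apply/eqP/eq_bigr => u _; rewrite !mxE mul1r; apply: eq_bigr => v _.
    by rewrite !mxE mulr1 -natrM mulnb andbb.
  rewrite mxE => /eqP; rewrite psumr_eq0 => [/allP w0|i _]; last first.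
    by rewrite mxE -expr2 sqr_ge0.
  apply/colP => i; have := w0 i (mem_index_enum _).
  by rewrite mxE mulf_eq0 orbb => /eqP ->; rewrite mxE.
apply/esym/eqP; rewrite -subr_eq0 -mul_scalar_mx -mulmxBl -sA -mulmxA s1.
by rewrite mulmx0.
Qed.

Lemma sum_horner_adjmx (q : {poly R}) : A *m one = lam ord0 *: one ->
  \sum_u \sum_v horner_mx A q u v = n.+1%:R * q.[lam ord0].
Proof. by move=> A1; apply/sum_mx_one/horner_mx_eigen. Qed.

(** * The Hoffman polynomial *)

Local Notation hoffman := (\sum_(i < d.+1) p i).

(** Orthogonality gives [<H, p_k> = |p_k|^2 = p_k(lam_0)] for the Hoffman polynomial [H]. Both sides
    are linear in [q] and depend only on its values on the spectrum, and the [p_k] span all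
    polynomials of degree at most [d]. *)
Lemma graph_sprod_hoffman (q : {poly R}) :
  graph_sprod e hoffman q = q.[lam ord0].
Proof.
have n0 : n.+1%:R != 0 :> R by rewrite pnatr_eq0.
(* Since [m] vanishes on the spectrum, [m(A) = 0], and [q] may be replaced by its remainder modulo
   [m]. *)
pose m := \prod_(z <- [seq lam j | j <- enum 'I_d.+1]) ('X - z%:P).
have sm : size m = d.+2 by rewrite size_prod_XsubC size_map size_enum_ord.
have m0 j : m.[lam j] = 0.
  by apply/rootP; rewrite root_prod_XsubC map_f // mem_enum.
have mA : horner_mx A m = 0 by apply: horner_adjmx_spectrum.
have lin a f g : graph_sprod e hoffman (a *: f + g) =
    a * graph_sprod e hoffman f + graph_sprod e hoffman g.
  apply: (mulfI n0); rewrite mulrDr [_ * (a * _)]mulrCA !graph_sprodE mulrDr -scalerAr.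
  by rewrite rmorphD /= !linearD linearZ /= mxtraceZ.
have modE : graph_sprod e hoffman q = graph_sprod e hoffman (q %% m)%R.
  rewrite {1}(divp_eq q m) /graph_sprod rmorphD rmorphM /= mA mulr0.
  by rewrite add0r.
rewrite modE [in RHS](divp_eq q m) hornerD hornerM m0 mulr0 add0r.
have : (size (q %% m)%R <= d.+1)%N.
  by rewrite -ltnS -sm ltn_modp -size_poly_gt0 sm.
move: (q %% m)%R => {q modE} q.
suff small k (r : {poly R}) : (k <= d.+1)%N -> (size r <= k)%N ->
    graph_sprod e hoffman r = r.[lam ord0] by exact: small.
elim: k r => [|k IHk] {}q kd.
  rewrite leqn0 size_poly_eq0 => /eqP ->; rewrite horner0.
  by apply: (mulfI n0); rewrite graph_sprodE !mulr0 rmorph0 mxtrace0.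
move=> qk; have pk := size_predist k kd.
have lk : (p k)`_k != 0.
  by rewrite -[X in _`_X]/(k.+1.-1) -pk -lead_coefE lead_coef_eq0 -size_poly_eq0 pk.
(* This [c] cancels the coefficient of degree [k], so the induction hypothesis applies to
   [q - c p_k]. *)
pose c := q`_k / (p k)`_k; have qE : q = c *: p k + (q - c *: p k).
  by rewrite addrC subrK.
rewrite qE lin (IHk (q - c *: p k)); last 2 first.
- exact: ltnW.
- apply/leq_sizeP => j; rewrite leq_eqVlt => /predU1P[<-|kj].
    by rewrite coefB coefZ divfK ?subrr.
  rewrite coefB coefZ !nth_default ?mulr0 ?subrr // ?pk //.
  exact: leq_trans qk kj.
rewrite [RHS]hornerD hornerZ; congr (_ * _ + _).
apply: (mulfI n0); rewrite graph_sprod_sum rmorph_sum /=.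
under eq_bigr do under eq_bigr do rewrite summxE mulr_suml.
under eq_bigr do rewrite exchange_big /=.
rewrite exchange_big /= (bigD1 (Ordinal kd)) //= predist_norm // big1 ?addr0 //.
by move=> i ik; apply: predist_orth => //; rewrite -ltnS.
Qed.

(* [|(x - lam_0) H|^2 = <H, (x - lam_0)^2 H> = 0], so the columns of [H(A)] are
   eigenvectors for [lam_0]. *)
Lemma hoffman_adjmx : A *m one = lam ord0 *: one ->
  \sum_(i < d.+1) pA i = const_mx 1.
Proof.
move=> A1; rewrite -(rmorph_sum (horner_mx A)) /=.
pose g : {poly R} := 'X - (lam ord0)%:P.
have gH : horner_mx A (g * hoffman) = 0.
  apply: mxtrace_sym_sqr_eq0; first exact: horner_mx_sym adjmx_sym.
  rewrite mulmxE -rmorphM /=.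
  have -> : g * hoffman * (g * hoffman) = hoffman * (g * g * hoffman) by ring.
  rewrite -graph_sprodE graph_sprod_hoffman !hornerM hornerXsubC subrr.
  by rewrite !mul0r mulr0.
have Hsym := horner_mx_sym A hoffman adjmx_sym.
have colH (j : 'I_n.+1) u v : horner_mx A hoffman u j = horner_mx A hoffman v j.
  have := adjmx_eigen_const (lam ord0) (col j (horner_mx A hoffman)) u v A1.
  rewrite !mxE; apply; apply/eqP; rewrite -subr_eq0 colE -mul_scalar_mx -mulmxBl.
  move: gH; rewrite mulmxA rmorphM rmorphB /= horner_mx_X horner_mx_C mulmxE => ->.
  by rewrite mul0mx.
have HE u v : horner_mx A hoffman u v = horner_mx A hoffman ord0 ord0.
  by rewrite (colH v u ord0) -{1}Hsym mxE; apply: colH.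
apply/matrixP => u v; rewrite HE mxE.
(* As [<H, 1> = 1], the trace of [H(A)] is the number of vertices, so the common entry is 1. *)
have := graph_sprod_hoffman 1; rewrite hornerC => /(congr1 ( *%R n.+1%:R)).
rewrite graph_sprodE mulr1 mulr1 /mxtrace; under eq_bigr do rewrite HE.
rewrite sumr_const card_ord -[LHS]mulr_natl -[RHS]mulr1; apply: mulfI.
by rewrite pnatr_eq0.
Qed.

(** * Distance matrices as values of the predistance polynomials *)

(** At a distance above [d] every [p_i(A)] has entry 0, against the sum 1 in the Hoffman
    identity. *)
Lemma gdist_le_spectrum (u v : 'I_n.+1) :
  A *m one = lam ord0 *: one -> (gdist e u v <= d)%N.
Proof.
move=> A1; rewrite leqNgt; apply/negP => ltd.
have /matrixP/(_ u v) := hoffman_adjmx A1; rewrite summxE mxE big1 => [|i _].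
  by move/eqP; rewrite eq_sym oner_eq0.
apply: horner_adjmx_gdist; rewrite size_predist; last by rewrite -ltnS.
exact: leq_trans (ltn_ord i) ltd.
Qed.

(* With entrywise products, orthogonality and the norm condition say that
   [P^2 - P + P (A_k + A_{k+1})] has entry sum 0 for [P := p_{k+2}(A)].
   Its entries are nonnegative because, off distances k and k+1, those of P are
   natural numbers. *)
Lemma predist_distmx_step k : A *m one = lam ord0 *: one ->
  (k.+2 <= d)%N -> gamma k.+2 = 1 ->
  pA k = distmx k -> pA k.+1 = distmx k.+1 -> pA k.+2 = distmx k.+2.
Proof.
move=> A1 kd g1 pk pk1; set P := pA k.+2.
have PE u v : P u v = (nbr_num _ e k.+1 u v)%:R - beta k * distmx k u v
                      - alpha k.+1 * distmx k.+1 u v.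
  have := predist_adjmx k.+1 kd; rewrite g1 scale1r pk1 pk.
  move=> /matrixP/(_ u v); rewrite distmx_adjmx !mxE => ->.
  by rewrite -/P; ring.
pose Q u v := P u v * P u v - P u v + P u v * (distmx k u v + distmx k.+1 u v).
have Q0 : \sum_u \sum_v Q u v = 0.
  under eq_bigr do rewrite big_split sumrB /=.
  rewrite big_split sumrB /= predist_norm // sum_horner_adjmx // subrr add0r.
  under eq_bigr do under eq_bigr do rewrite mulrDr.
  under eq_bigr do rewrite big_split /=.
  rewrite big_split /= -pk -pk1 !predist_orth ?addr0 //; lia.
have far u v : gdist e u v != k -> gdist e u v != k.+1 ->
    [/\ P u v = (nbr_num _ e k.+1 u v)%:R & Q u v = P u v * P u v - P u v].
  move=> gk gk1; rewrite /Q PE !mxE (negbTE gk) (negbTE gk1).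
  by rewrite !mulr0 !subr0 addr0 mulr0 addr0.
have near u v : (gdist e u v == k) || (gdist e u v == k.+1) -> Q u v = P u v * P u v.
  rewrite /Q !mxE; case/orP => /eqP ->; rewrite eqxx.
    by rewrite ltn_eqF // addr0 mulr1 subrK.
  by rewrite gtn_eqF // add0r mulr1 subrK.
have Q_ge0 u v : 0 <= Q u v.
  have [/near ->|] := boolP ((gdist e u v == k) || (gdist e u v == k.+1)).
    by rewrite -expr2 sqr_ge0.
  rewrite negb_or => /andP[/far gk /gk[-> ->]].
  by rewrite subr_ge0 -natrM ler_nat; nia.
have {Q0} Q0 u v : Q u v = 0.
  move/eqP: Q0; rewrite psumr_eq0 => [/allP/(_ u (mem_index_enum _))|x _]; last first.
    exact: sumr_ge0.
  by rewrite psumr_eq0 => [/allP/(_ v (mem_index_enum _))/eqP|].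
apply/matrixP => u v; rewrite [RHS]mxE.
have [g|] := boolP ((gdist e u v == k) || (gdist e u v == k.+1)).
  have /eqP := near u v g; rewrite Q0 eq_sym mulf_eq0 orbb => /eqP ->.
  by case/orP: g => /eqP ->; rewrite ltn_eqF.
rewrite negb_or => /andP[gk gk1]; have [PN] := far u v gk gk1.
rewrite Q0 PN => /esym/eqP; rewrite subr_eq0 -natrM eqr_nat => /eqP NN.
(* Now the count is 0 or 1. At distance [k + 2] the last edge of a shortest walk makes it positive;
   a nonzero count requires a distance between [k] and [k + 2]. *)
case: eqP => [/(nbr_num_gt0 _ _ e_sym e_conn) N0|/eqP gk2].
  by apply/eqP; rewrite eqr_nat; nia.
apply/eqP; rewrite pnatr_eq0; apply: contraTT isT => N0.
have := nbr_num_neq0 _ _ e_sym e_conn _ _ _ N0; lia.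
Qed.

Lemma predist_distmx m : A *m one = lam ord0 *: one -> p 1%N = 'X ->
  (m <= d)%N -> (forall i, (1 <= i <= m)%N -> gamma i = 1) ->
  forall i, (i <= m)%N -> pA i = distmx i.
Proof.
move=> A1 p1 md g1 i; elim/ltn_ind: i => -[|[|k]] IHk km.
- by rewrite predist0 rmorph1 distmx0.
- by rewrite p1 horner_mx_X distmx1.
by apply: predist_distmx_step; rewrite ?IHk ?g1 //; lia.
Qed.

(** For [j < d] the recurrence writes [A_j A] as a combination of distance matrices. For [j = d],
    [A_d] is the all-ones matrix [J] minus the other [A_j], and [J A = lam_0 J]. Beyond [d] the
    distance matrices vanish. *)
Lemma predist_distmx_regular : A *m one = lam ord0 *: one ->
  (forall i, (i <= d)%N -> pA i = distmx i) -> distance_regular e.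
Proof.
move=> A1 pE; apply: distance_regular_distmx => i.
have rec j : (j < d)%N -> exists F : nat -> R, forall u v,
    (distmx j *m A) u v = F (gdist e u v).
  move=> jd; exists (fun g => (if j is k.+1 then beta k * (g == k)%:R else 0)
     + alpha j * (g == j)%:R + gamma j.+1 * (g == j.+1)%:R) => u v.
  have := predist_adjmx j jd; rewrite (pE j (ltnW jd)) (pE j.+1 jd) => ->.
  case: j jd => [|k] kd; first by rewrite !mxE.
  by rewrite pE ?mxE //; lia.
case: (ltngtP i d) => [/rec //|di|->].
  exists (fun=> 0) => u v; rewrite mxE big1 // => w _; rewrite mxE.
  by rewrite ltn_eqF ?mul0r // (leq_ltn_trans _ di) // gdist_le_spectrum.
have [F FE] : exists F : nat -> nat -> R, forall j u v, (j < d)%N ->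
    (distmx j *m A) u v = F j (gdist e u v).
  (* Choice gathers the functions into one family that can be summed over [j]; for [j >= d] the zero
     function is a dummy value. *)
  have /boolp.choice[F FE] : forall j, exists F : nat -> R, (j < d)%N -> forall u v,
      (distmx j *m A) u v = F (gdist e u v).
    by move=> j; case: (ltnP j d) => [/rec[F FE]|]; [exists F | exists (fun=> 0)].
  by exists F => j u v /FE.
exists (fun g => lam ord0 - \sum_(j < d) F j g) => u v.
have -> : distmx d = const_mx 1 - \sum_(j < d) distmx j.
  rewrite -(hoffman_adjmx A1) big_ord_recr /= addrC pE //.
  under eq_bigr => j _ do rewrite pE 1?ltnW //.
  by rewrite addrK.
rewrite mulmxBl mulmx_suml mxE; congr (_ + _); last first.
  by rewrite mxE summxE; congr (- _); apply: eq_bigr => j _; exact: FE.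
(* Column sums of [A] are degrees, hence [lam_0]. *)
have /matrixP/(_ v 0) := A1; rewrite !mxE mulr1 => <-.
by apply: eq_bigr => w _; rewrite !mxE mulr1 mul1r e_sym.
Qed.

(** * Parity in bipartite graphs *)

(** Multiplication by [A] swaps parity, so the recurrence carries the claim from [i - 1] and [i] to
    [i + 1] once [alpha_i = 0] is known. *)
Lemma bipartite_predist (f : 'I_n.+1 -> bool) :
  (forall u v, e u v -> f u != f v) ->
  forall i u v, (i <= d)%N -> f u (+) f v != odd i -> pA i u v = 0.
Proof.
move=> fP; elim/ltn_ind => -[|i] IHi u v id par.
  by rewrite predist0 rmorph1 mxE; case: (u =P v) par => [->|//]; rewrite addbb.
have parA j x y : (j <= i)%N -> f x (+) f y != odd j.+1 -> (pA j *m A) x y = 0.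
  move=> ji par'; rewrite mxE big1 // => w _; rewrite [A w y]mxE.
  case wy: (e w y); rewrite ?mulr0 // IHi ?mul0r //; first lia.
  have := fP w y wy; move: par' => /=.
  by case: (f x) (f y) (f w) (odd j) => [] [] [] [].
have recE x y := congr1 (fun M : 'M[R]_n.+1 => M x y) (predist_adjmx i id).
have prevE x y : f x (+) f y != odd i.+1 ->
    (if i is k.+1 then beta k *: pA k else 0) x y = 0.
  case: (i) IHi id => [|k] IHi id par' /=; rewrite mxE // IHi ?mulr0 //; first lia.
  by move: par' => /=; rewrite negbK.
(* On pairs of parity [i] the recurrence reduces to [0 = alpha_i p_i(A) + gamma_(i+1) p_(i+1)(A)].
   Multiplying entrywise by [p_i(A)], which vanishes on the other pairs, and summing leaves
   [alpha_i |p_i|^2 = 0] by orthogonality. *)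
have a0 : alpha i = 0.
  have pi0 : p i != 0 by rewrite -size_poly_eq0 size_predist // ltnW.
  have si : (size (p i) <= d.+1)%N by rewrite size_predist // ltnW.
  apply/eqP; have := graph_sprod_neq0 (p i) si pi0.
  apply: contraNT => a0.
  suff : alpha i * \sum_x \sum_y pA i x y * pA i x y = 0.
    rewrite -graph_sprod_sum => /eqP; rewrite !mulf_eq0 (negbTE a0).
    by rewrite pnatr_eq0.
  have : \sum_x \sum_y (alpha i * (pA i x y * pA i x y)
                         + gamma i.+1 * (pA i.+1 x y * pA i x y)) = 0.
    rewrite big1 // => x _; rewrite big1 // => y _.
    have [xy|/eqP xy] := boolP (f x (+) f y == odd i); last first.
      by rewrite [pA i x y]IHi ?mulr0 ?addr0 ?(ltnW id) //; apply/eqP.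
    have xy' : f x (+) f y != odd i.+1 by rewrite (eqP xy) /=; case: (odd i).
    have := recE x y; rewrite parA // [RHS]mxE [X in X + _]mxE prevE // add0r.
    rewrite [X in X + _]mxE [X in _ + X]mxE !mulrA -mulrDl => <-.
    by rewrite mul0r.
  under eq_bigr do rewrite big_split -!mulr_sumr /=.
  rewrite big_split -!mulr_sumr /= (predist_orth i.+1 i) ?mulr0 ?addr0 ?(ltnW id) //.
  by rewrite gtn_eqF.
have := recE u v; rewrite parA // a0 scale0r addr0 [RHS]mxE prevE // add0r mxE.
by move=> /esym/eqP; rewrite mulf_eq0 (negbTE (gamma_neq0 i id)) => /eqP.
Qed.

(** * Recovering the last predistance matrices *)

Lemma sum_distmx m (u v : 'I_n.+1) :
  \sum_(j < m) distmx j u v = (gdist e u v < m)%:R.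
Proof.
elim: m => [|m IHm]; first by rewrite big_ord0.
rewrite big_ord_recr /= IHm mxE ltnS.
by case: ltngtP; rewrite ?addr0 ?add0r.
Qed.

(** This is the tail of the Hoffman identity: the first [m] terms account exactly for the pairs at
    distance below [m]. *)
Lemma sum_predist_ge m (u v : 'I_n.+1) : A *m one = lam ord0 *: one ->
  (m <= d.+1)%N -> (forall i, (i < m)%N -> pA i = distmx i) ->
  \sum_(m <= i < d.+1) pA i u v = (m <= gdist e u v)%:R.
Proof.
move=> A1 md pE; have /matrixP/(_ u v) := hoffman_adjmx A1.
rewrite summxE mxE -(big_mkord xpredT (fun i => pA i u v)) (@big_cat_nat _ _ _ m) //=.
rewrite big_mkord (eq_bigr (fun i : 'I_m => distmx i u v)) => [|i _]; last by rewrite pE.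
rewrite sum_distmx; case: (leqP m (gdist e u v)) => _ /=; first by rewrite add0r.
by move=> /eqP; rewrite addrC -[X in _ == X]add0r (inj_eq (addIr _)) => /eqP.
Qed.

(** Only [p_d(A)] is left. The tail identity makes it the indicator of distance at least [d], and no
    distance exceeds [d]. *)
Lemma distance_regular_gamma_eq1 : (2 <= d)%N ->
  (forall i, (1 <= i <= d - 1)%N -> gamma i = 1) -> distance_regular e.
Proof.
move=> d2 g1; have [||p1 A1] := predist1_regular; first lia.
  by apply: g1; lia.
have md : (d - 1 <= d)%N by lia.
have pE := predist_distmx (d - 1) A1 p1 md g1.
apply: predist_distmx_regular => // i; rewrite leq_eqVlt.
case/predU1P => [->|id]; last by apply: pE; lia.
apply/matrixP => u v; rewrite mxE.
have := gdist_le_spectrum u v A1.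
have := sum_predist_ge d u v A1 (leqnSn d); rewrite big_nat1 => ->.
  by move=> ud; rewrite eqn_leq ud.
by move=> j jd; apply: pE; lia.
Qed.

(** The tail identity gives only the sum of [p_(d-1)(A)] and [p_d(A)]; their supports lie on
    distances of opposite parity, which separates the two. *)
Lemma bipartite_distance_regular_gamma_eq1 : (3 <= d)%N -> bipartite_graph e ->
  (forall i, (1 <= i <= d - 2)%N -> gamma i = 1) -> distance_regular e.
Proof.
move=> d3 [f fP] g1; have [||p1 A1] := predist1_regular; first lia.
  by apply: g1; lia.
have md : (d - 2 <= d)%N by lia.
have pE := predist_distmx (d - 2) A1 p1 md g1.
have par := bipartite_gdist _ _ e_sym e_conn f fP.
have off i u v : (i <= d)%N -> odd (gdist e u v) != odd i -> pA i u v = 0.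
  by move=> id; rewrite -par; apply: bipartite_predist.
have dE : (d - 1).+1 = d by lia.
have last2 u v : pA (d - 1) u v + pA d u v = ((d - 1)%N <= gdist e u v)%:R.
  have d1 : (d - 1 < d.+1)%N by lia.
  have := sum_predist_ge (d - 1) u v A1 (ltnW d1).
  rewrite (big_ltn d1) dE big_nat1 => -> //.
  by move=> j jd; apply: pE; lia.
have oddd : odd d = ~~ odd (d - 1) by rewrite -[X in odd X]dE.
apply: predist_distmx_regular => // i id.
have [|ltdi] := leqP i (d - 2); first exact: pE.
apply/matrixP => u v; rewrite mxE; have ud := gdist_le_spectrum u v A1.
have [g|g] := eqVneq (odd (gdist e u v)) (odd i); last first.
  by rewrite off //; case: (gdist e u v =P i) g => [->|//]; rewrite eqxx.
have [iE|iE] : i = d \/ i = (d - 1)%N by lia.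
- rewrite iE in g *; have := last2 u v; rewrite [X in X + _]off ?add0r; first last.
  + by rewrite g oddd; case: odd.
  + exact: leq_subr.
  move=> ->; congr (_ %:R : R); congr nat_of_bool.
  (* Parity rules out [d - 1], so a distance of at least [d - 1] and at most [d] equals [d]. *)
  have : gdist e u v != (d - 1)%N.
    by apply: contra_eq_neq g => ->; rewrite oddd; case: odd.
  lia.
rewrite iE in g *; have := last2 u v; rewrite [X in _ + X]off ?addr0 //; last first.
  by rewrite g oddd; case: odd.
move=> ->; congr (_ %:R : R); congr nat_of_bool.
have : gdist e u v != d by apply: contra_eq_neq g => ->; rewrite oddd; case: odd.
lia.
Qed.

End Graph.


Theorem theorem4p9 (R : realType) (n : nat) (e : rel 'I_n.+1)
    (e_sym : symmetric e) (e_irr : irreflexive e) (e_conn : connected_graph e)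
    (d : nat) (lam : 'I_d.+1 -> R) (lam_spec : distinct_eigenvalues e lam)
    (p : nat -> {poly R}) (p_pre : predistance_polys e lam p)
    (alpha beta gamma : nat -> R)
    (abc_pre : preintersection_numbers lam p alpha beta gamma) :
  ((2 <= d)%N ->
   (forall i : nat, (1 <= i <= d - 1)%N -> gamma i = 1) ->
   distance_regular e)
  /\
  ((3 <= d)%N -> bipartite_graph e ->
   (forall i : nat, (1 <= i <= d - 2)%N -> gamma i = 1) ->
   distance_regular e).
Proof.
split.
  exact: (distance_regular_gamma_eq1 _ _ _ e_sym e_irr e_conn
            _ _ _ _ _ _ lam_spec p_pre abc_pre).
exact: (bipartite_distance_regular_gamma_eq1 _ _ _ e_sym e_irr e_conn
          _ _ _ _ _ _ lam_spec p_pre abc_pre).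
Qed.
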